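(* Fix a positive integer $n$. For ordinal spaces $(X,\delta_X)$ and $(Y,\delta_Y)$ with $|X|=|Y|=n$ put $$d_{ord}(X,Y)=\min_{f}\frac18\Bigl|\{(x,y,z,w)\in X^4\mid\delta_X(x,y,z,w)\neq\delta_Y(f(x),f(y),f(z),f(w))\}\Bigr|,$$ where the minimum is over all bijections $f\colon X\to Y$, and for isomorphic types put $d_{ord}(\operatorname{is}(X),\operatorname{is}(Y))=d_{ord}(X,Y)$. Then $d_{ord}$ is a metric on the set of isomorphic types of finite ordinal spaces with $n$ points.
   Context: An ordinal space $(X,\delta)$ is a nonempty set $X$ with a map $\delta\colon X^4\to\{\text{`}<\text{'},\text{`}>\text{'},\text{`}=\text{'}\}$ such that for all $x,y,u,v,z,w\in X$: (i) $\delta(x,y,x,y)=$ `$=$'; (ii) $\delta(x,y,z,w)=\delta(y,x,z,w)=\delta(x,y,w,z)$; (iii) $\delta(x,y,z,w)=-\delta(z,w,x,y)$, where $-$ interchanges `$<$' and `$>$' and fixes `$=$'; (iv) $\delta(x,y,u,v)=\delta(u,v,z,w)=$ `$=$' implies $\delta(x,y,z,w)=$ `$=$'; (v) $\delta(x,y,u,v)=$ `$<$' and $\delta(u,v,z,w)\in\{$`$<$', `$=$'$\}$ implies $\delta(x,y,z,w)=$ `$<$'; (vi) $\delta(x,y,u,v)\in\{$`$<$', `$=$'$\}$ and $\delta(u,v,z,w)=$ `$<$' implies $\delta(x,y,z,w)=$ `$<$'; (vii) $\delta(x,x,z,w)=$ `$<$' if $z\neq w$ and $\delta(x,x,z,w)=$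 `$=$' if $z=w$. Ordinal spaces $(X,\delta_X)$ and $(Y,\delta_Y)$ are isomorphic if there exists a bijection $\Phi\colon X\to Y$ with $\delta_X(x,y,z,w)=\delta_Y(\Phi(x),\Phi(y),\Phi(z),\Phi(w))$ for all $x,y,z,w\in X$. The isomorphic type $\operatorname{is}(X)$ is the class of all ordinal spaces isomorphic to $X$. *)

(* Defs.v *)
From mathcomp Require Import all_boot all_order all_algebra finmap.
From mathcomp Require Import boolp classical_sets functions cardinality reals.

Set Implicit Arguments.
Unset Strict Implicit.
Unset Printing Implicit Defensive.

Import Order.TTheory GRing.Theory Num.Theory.

Local Open Scope classical_set_scope.
Local Open Scope card_scope.
Local Open Scope ring_scope.

(* The symbols '<', '>', '=' are the constructors Lt, Gt, Eq of comparison, and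
   CompOpp is the involution written "-" on them. *)
Record is_ordinal_space (X : Type) (delta : X -> X -> X -> X -> comparison) :
    Prop := IsOrdinalSpace {
  ordinal_nonempty : [set: X] !=set0 ;
  ordinal_refl : forall x y, delta x y x y = Eq ;
  ordinal_sym : forall x y z w,
    delta x y z w = delta y x z w /\ delta y x z w = delta x y w z ;
  ordinal_opp : forall x y z w, delta x y z w = CompOpp (delta z w x y) ;
  ordinal_eq_trans : forall x y u v z w,
    delta x y u v = Eq -> delta u v z w = Eq -> delta x y z w = Eq ;
  ordinal_lt_le_trans : forall x y u v z w,
    delta x y u v = Lt -> delta u v z w = Lt \/ delta u v z w = Eq ->
    delta x y z w = Lt ;
  ordinal_le_lt_trans : forall x y u v z w,
    delta x y u v = Lt \/ delta x y u v = Eq -> delta u v z w = Lt ->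
    delta x y z w = Lt ;
  ordinal_diag : forall x z w,
    (z <> w -> delta x x z w = Lt) /\ (z = w -> delta x x z w = Eq)
}.

Record ordinalSpace := OrdinalSpace {
  carrier :> Type ;
  delta : carrier -> carrier -> carrier -> carrier -> comparison ;
  ordinalSpaceP : is_ordinal_space delta
}.

Definition isomorphic (X Y : ordinalSpace) : Prop :=
  exists2 f : X -> Y, bijective f &
    forall x y z w, delta x y z w = delta (f x) (f y) (f z) (f w).

Definition iso_type (X : ordinalSpace) : set ordinalSpace :=
  [set Y | isomorphic Y X].

Definition has_points (n : nat) (X : ordinalSpace) : Prop :=
  [set: X] #= `I_n.

Definition iso_types (n : nat) : set (set ordinalSpace) :=
  [set iso_type X | X in has_points n].

(* Quadruples are nested as (((x, y), z), w).  fset_set A is the finite set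
   underlying A (and is empty if A is infinite, which does not occur when X has
   finitely many points); {classic T} is T with classical choice. *)
Definition mismatch (X Y : ordinalSpace) (f : X -> Y) : nat :=
  #|` fset_set [set q : {classic X * X * X * X} |
        let: (x, y, z, w) := q in
        delta x y z w <> delta (f x) (f y) (f z) (f w)] |.

(* The default value 0 is only returned when A has no least element. *)
Definition minimum (R : realType) (A : set R) : R := xget 0 (A `&` lbound A).

Definition d_ord (R : realType) (X Y : ordinalSpace) : R :=
  minimum [set 8^-1 * (mismatch f)%:R | f in [set f : X -> Y | bijective f]].

(* The common value of d_ord on representatives; that this set is a singleton
   when C and D are isomorphic types with the same finite number of points is
   not assumed here. *)
Definition d_ord_iso (R : realType) (C D : set ordinalSpace) : R :=
  xget 0 [set d_ord R X Y | X in C & Y in D].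

Definition metric_on (R : realType) (T : Type) (S : set T) (d : T -> T -> R) :
    Prop :=
  [/\ forall a b, S a -> S b -> 0 <= d a b,
      forall a b, S a -> S b -> (d a b = 0 <-> a = b),
      forall a b, S a -> S b -> d a b = d b a &
      forall a b c, S a -> S b -> S c -> d a c <= d a b + d b c].

(* Main.v *)
Require Import Defs.
From mathcomp Require Import all_boot all_order all_algebra.
From mathcomp Require Import boolp classical_sets reals.
From mathcomp Require Import finmap functions cardinality.

(** A bijection [f : X -> Y] is as far from being an isomorphism as its number
    [mismatch f] of badly mapped quadruples tells.  This count behaves like a
    length: it vanishes exactly when [f] is an isomorphism
    ([mismatch_eq0]), it does not change when [f] is inverted
    ([mismatch_inv_le]), and it is subadditive under composition
    ([mismatch_comp]), because a quadruple badly mapped by [g \o f] is either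
    badly mapped by [f], or sent by [f] to a quadruple badly mapped by [g].

    Counts are natural numbers, so the minimum defining [d_ord X Y] is attained
    as soon as [X] and [Y] are equipotent ([d_ord_attained]).  Evaluating
    [mismatch] at optimal bijections turns the three properties above into the
    axioms of a pseudometric on spaces with [n] points, in which two spaces are
    at distance [0] if and only if they are isomorphic.  Dividing a pseudometric
    by its relation of being at distance [0] gives a metric; independence of the
    representatives ([d_ord_isoE]) is the triangle inequality applied to two
    null distances. *)

Set Implicit Arguments.
Unset Strict Implicit.
Unset Printing Implicit Defensive.

Import Order.TTheory GRing.Theory Num.Theory.

Local Open Scope classical_set_scope.
Local Open Scope card_scope.
Local Open Scope ring_scope.

(** * Isomorphisms and numbers of points *)

Lemma isomorphic_refl (X : ordinalSpace) : isomorphic X X.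
Proof. by exists id => //; exists id. Qed.

Lemma isomorphic_sym (X Y : ordinalSpace) : isomorphic X Y -> isomorphic Y X.
Proof.
move=> [f [g fK gK] fP]; exists g; first by exists f.
by move=> x y z w; rewrite fP !gK.
Qed.

Lemma isomorphic_trans (Y X Z : ordinalSpace) :
  isomorphic X Y -> isomorphic Y Z -> isomorphic X Z.
Proof.
move=> [f f_bij fP] [g g_bij gP]; exists (g \o f); first exact: bij_comp.
by move=> x y z w; rewrite fP gP.
Qed.

Lemma iso_type_eqP (X Y : ordinalSpace) :
  iso_type X = iso_type Y <-> isomorphic X Y.
Proof.
split=> [eqXY | isoXY].
  by have := isomorphic_refl X; rewrite -[isomorphic X X]/(iso_type X X) eqXY.
apply/seteqP; split=> Z isoZ /=; first exact: isomorphic_trans isoXY.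
exact/(isomorphic_trans isoZ)/isomorphic_sym.
Qed.

Lemma isomorphic_has_points n (X Y : ordinalSpace) :
  isomorphic X Y -> has_points n Y -> has_points n X.
Proof.
move=> [f f_bij _]; apply: card_eq_trans.
by rewrite -setTT_bijective in f_bij; have [F _] := Pbij f_bij; apply: pcard_eq.
Qed.

Lemma has_points_finite n (X : ordinalSpace) :
  has_points n X -> finite_set [set: X].
Proof. by move=> Xn; apply/finite_setP; exists n. Qed.

Lemma has_points_bijection n (X Y : ordinalSpace) :
  has_points n X -> has_points n Y -> exists f : X -> Y, bijective f.
Proof.
move=> Xn Yn; have /card_bijP[f f_bij] := card_eq_trans Xn (card_esym Yn).
(* The default value [y] of [valLR] is never reached: [f] is defined on all of
   [X]. *)
have [y _] := ordinal_nonempty (ordinalSpaceP Y).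
by exists (valLR y f); rewrite -setTT_bijective; apply/valLR_bijP.
Qed.

(** * The number of mismatched quadruples *)

Section FiniteCardinal.
Local Open Scope nat_scope.

Lemma leq_card_fset_set_inj (T U : choiceType) (h : T -> U)
    (A : set T) (B : set U) :
  injective h -> finite_set A -> finite_set B -> {homo h : x / A x >-> B x} ->
  #|` fset_set A| <= #|` fset_set B|.
Proof.
move=> h_inj Afin Bfin hAB.
have <- : #|` fset_set (h @` A)| = #|` fset_set A|.
  by rewrite fset_set_image// card_imfset.
apply: fsubset_leq_card; rewrite -fset_set_sub//; last exact: finite_image.
by move=> _ [x Ax <-]; apply: hAB.
Qed.

End FiniteCardinal.

(** Naming the set counted by [mismatch] allows bounding counts by inclusions
    between images, preimages and unions. *)
Definition mismatch_set (X Y : ordinalSpace) (f : X -> Y) :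
    set {classic X * X * X * X} :=
  [set q | let: (x, y, z, w) := q in
           delta x y z w <> delta (f x) (f y) (f z) (f w)].

Definition quad_map (X Y : Type) (f : X -> Y) (q : {classic X * X * X * X}) :
    {classic Y * Y * Y * Y} :=
  let: (x, y, z, w) := q in (f x, f y, f z, f w).

Lemma quad_map_inj (X Y : Type) (f : X -> Y) :
  injective f -> injective (quad_map f).
Proof.
by move=> f_inj [[[x y] z] w] [[[x' y'] z'] w'] [] /f_inj-> /f_inj-> /f_inj->
  /f_inj->.
Qed.

Lemma finite_quad (X : Type) (A : set {classic X * X * X * X}) :
  finite_set [set: X] -> finite_set A.
Proof.
move=> Xfin.
have fin4 := finite_setX (finite_setX (finite_setX Xfin Xfin) Xfin) Xfin.
by apply: sub_finite_set fin4 => -[[[x y] z] w].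
Qed.

Section Mismatch.
Local Open Scope nat_scope.
Implicit Types X Y Z : ordinalSpace.

Lemma mismatch_eq0 X Y (f : X -> Y) : finite_set [set: X] ->
  mismatch f = 0 <->
  forall x y z w, delta x y z w = delta (f x) (f y) (f z) (f w).
Proof.
move=> Xfin; have Mfin : finite_set (mismatch_set f) := finite_quad _ Xfin.
split=> [/cardfs0_eq/(fset_set_set0 Mfin) M0 x y z w | fP].
  apply: contrapT => neq.
  suff : set0 (x, y, z, w) by [].
  by rewrite -M0.
have M0 : mismatch_set f = set0.
  by rewrite -subset0 => -[[[x y] z] w] /(_ (fP _ _ _ _)).
by rewrite /mismatch -/(mismatch_set f) M0 fset_set0.
Qed.

(** Only an inequality is needed: exchanging [f] and [g] gives the other one.
    The inverse [g] carries the quadruples that it maps badly injectively to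
    quadruples badly mapped by [f]. *)
Lemma mismatch_inv_le X Y (f : X -> Y) (g : Y -> X) :
  finite_set [set: X] -> finite_set [set: Y] -> cancel f g -> cancel g f ->
  mismatch g <= mismatch f.
Proof.
move=> Xfin Yfin fK gK.
apply: (@leq_card_fset_set_inj _ _ (quad_map g)).
- exact/quad_map_inj/(can_inj gK).
- exact: finite_quad.
- exact: finite_quad.
- by move=> [[[x y] z] w] /=; rewrite !gK => neq /esym.
Qed.

(** The quadruples badly mapped by [g \o f] lie in the union of those badly
    mapped by [f] and of the preimage [B] under [quad_map f] of those badly
    mapped by [g]; injectivity of [f] bounds the size of [B]. *)
Lemma mismatch_comp X Y Z (f : X -> Y) (g : Y -> Z) :
  finite_set [set: X] -> finite_set [set: Y] -> injective f ->
  mismatch (g \o f) <= mismatch f + mismatch g.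
Proof.
move=> Xfin Yfin f_inj.
pose B := quad_map f @^-1` mismatch_set g.
have leBg : #|` fset_set B| <= mismatch g.
  by apply: (leq_card_fset_set_inj (quad_map_inj f_inj)) => //;
    exact: finite_quad.
apply: leq_trans (leq_add (leqnn _) leBg); rewrite -cardfsUI.
apply: leq_trans (leq_addr _ _).
rewrite -fset_setU; [|exact: finite_quad..].
apply: fsubset_leq_card; rewrite -fset_set_sub; [|exact: finite_quad..].
move=> [[[x y] z] w] /= neq; rewrite /setU/=.
have [eqf|] := pselect (delta x y z w = delta (f x) (f y) (f z) (f w)).
  by right; rewrite /B /= -eqf.
by left.
Qed.

End Mismatch.

(** * The pseudometric on ordinal spaces *)

Section Pseudometric.
Variables (R : realType) (n : nat).
Implicit Types X Y Z : ordinalSpace.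

Lemma d_ord_attained X Y : has_points n X -> has_points n Y ->
  exists f : X -> Y, [/\ bijective f, d_ord R X Y = 8^-1 * (mismatch f)%:R &
    forall g : X -> Y, bijective g -> (mismatch f <= mismatch g)%N].
Proof.
move=> Xn Yn.
pose attained k := `[< exists2 f : X -> Y, bijective f & mismatch f = k >].
have attained_ex : exists k, attained k.
  have [f f_bij] := has_points_bijection Xn Yn.
  by exists (mismatch f); apply/asboolP; exists f.
case: (ex_minnP attained_ex) => _ /asboolP[f f_bij <-] f_min.
have {}f_min (g : X -> Y) : bijective g -> (mismatch f <= mismatch g)%N.
  by move=> g_bij; apply: f_min; apply/asboolP; exists g.
exists f; split=> //; rewrite /d_ord /minimum.
have f_lb : lbound [set 8^-1 * (mismatch g)%:R
    | g in [set g : X -> Y | bijective g]] (8^-1 * (mismatch f)%:R : R).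
  move=> _ [g /= g_bij <-].
  by rewrite ler_wpM2l ?invr_ge0 ?ler0n// ler_nat f_min.
apply: xget_unique; first by split=> //; exists f.
move=> r [r_in r_lb]; apply/le_anti; rewrite f_lb// andbT.
by apply: r_lb; exists f.
Qed.

Lemma d_ord_le X Y (f : X -> Y) : has_points n X -> has_points n Y ->
  bijective f -> d_ord R X Y <= 8^-1 * (mismatch f)%:R.
Proof.
move=> Xn Yn f_bij; have [g [_ -> g_min]] := d_ord_attained Xn Yn.
by rewrite ler_wpM2l ?invr_ge0 ?ler0n// ler_nat g_min.
Qed.

Lemma d_ord_ge0 X Y : has_points n X -> has_points n Y -> 0 <= d_ord R X Y.
Proof.
move=> Xn Yn; have [f [_ -> _]] := d_ord_attained Xn Yn.
by rewrite mulr_ge0 ?invr_ge0 ?ler0n.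
Qed.

Lemma d_ord_eq0 X Y : has_points n X -> has_points n Y ->
  d_ord R X Y = 0 <-> isomorphic X Y.
Proof.
move=> Xn Yn; have Xfin := has_points_finite Xn.
split=> [d0 | [f f_bij fP]].
  have [f [f_bij df _]] := d_ord_attained Xn Yn; exists f => //.
  apply/(mismatch_eq0 f Xfin)/eqP; rewrite -(eqr_nat R); apply/eqP.
  by move/eqP: d0; rewrite df mulf_eq0 invr_eq0 pnatr_eq0 => /eqP.
apply/le_anti; rewrite d_ord_ge0// andbT.
have := d_ord_le Xn Yn f_bij.
by rewrite (mismatch_eq0 f Xfin).2// mulr0.
Qed.

Lemma d_ord_sym_le X Y : has_points n X -> has_points n Y ->
  d_ord R Y X <= d_ord R X Y.
Proof.
move=> Xn Yn; have [f [[g fK gK] -> _]] := d_ord_attained Xn Yn.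
have g_bij : bijective g by exists f.
apply: le_trans (d_ord_le Yn Xn g_bij) _.
rewrite ler_wpM2l ?invr_ge0 ?ler0n// ler_nat.
by apply: mismatch_inv_le fK gK; apply: has_points_finite; eassumption.
Qed.

Lemma d_ord_sym X Y : has_points n X -> has_points n Y ->
  d_ord R X Y = d_ord R Y X.
Proof. by move=> Xn Yn; apply/le_anti; rewrite !d_ord_sym_le. Qed.

Lemma d_ord_triangle Y X Z :
  has_points n X -> has_points n Y -> has_points n Z ->
  d_ord R X Z <= d_ord R X Y + d_ord R Y Z.
Proof.
move=> Xn Yn Zn.
have [f [f_bij -> _]] := d_ord_attained Xn Yn.
have [g [g_bij -> _]] := d_ord_attained Yn Zn.
apply: le_trans (d_ord_le Xn Zn (bij_comp g_bij f_bij)) _.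
rewrite -mulrDr -natrD ler_wpM2l ?invr_ge0 ?ler0n// ler_nat.
apply: mismatch_comp (bij_inj f_bij); apply: has_points_finite; eassumption.
Qed.

(** * The metric on isomorphic types *)

(** Isomorphic spaces are at distance [0], so the detour
    [X' -> X -> Y -> Y'] costs no more than [d_ord R X Y]. *)
Lemma d_ord_isomorphic_le X X' Y Y' : has_points n X -> has_points n Y ->
  isomorphic X' X -> isomorphic Y' Y -> d_ord R X' Y' <= d_ord R X Y.
Proof.
move=> Xn Yn isoX isoY.
have X'n := isomorphic_has_points isoX Xn.
have Y'n := isomorphic_has_points isoY Yn.
apply: le_trans (d_ord_triangle X'n Xn Y'n) _.
rewrite ((d_ord_eq0 X'n Xn).2 isoX) add0r.
apply: le_trans (d_ord_triangle Xn Yn Y'n) _.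
by rewrite ((d_ord_eq0 Yn Y'n).2 (isomorphic_sym isoY)) addr0.
Qed.

(** Every pair of representatives can play the role of the reference pair
    [X], [Y] in the previous bound, so all their distances agree and the set
    defining [d_ord_iso] is a singleton. *)
Lemma d_ord_isoE X Y : has_points n X -> has_points n Y ->
  d_ord_iso R (iso_type X) (iso_type Y) = d_ord R X Y.
Proof.
move=> Xn Yn; apply: xget_unique.
  by exists X; [exact: isomorphic_refl | exists Y => //; exact: isomorphic_refl].
move=> _ [X' isoX [Y' isoY <-]]; apply/le_anti.
rewrite d_ord_isomorphic_le//= d_ord_isomorphic_le//;
  solve [exact: isomorphic_has_points isoX Xn | exact: isomorphic_has_points isoY Yn
        | exact: isomorphic_sym].
Qed.

End Pseudometric.

Theorem theorem9p2 (R : realType) (n : nat) (n_gt0 : (0 < n)%N) :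
  (forall X Y : ordinalSpace, has_points n X -> has_points n Y ->
     d_ord_iso R (iso_type X) (iso_type Y) = d_ord R X Y) /\
  metric_on (iso_types n) (d_ord_iso R).
Proof.
split=> [X Y|]; first exact: d_ord_isoE.
split=> [_ _ [X Xn <-] [Y Yn <-] | _ _ [X Xn <-] [Y Yn <-]
       | _ _ [X Xn <-] [Y Yn <-] | _ _ _ [X Xn <-] [Y Yn <-] [Z Zn <-]].
- by rewrite (d_ord_isoE R Xn Yn) (d_ord_ge0 R Xn Yn).
- rewrite (d_ord_isoE R Xn Yn) iso_type_eqP; exact: d_ord_eq0 Xn Yn.
- by rewrite (d_ord_isoE R Xn Yn) (d_ord_isoE R Yn Xn) (d_ord_sym R Xn Yn).
- rewrite (d_ord_isoE R Xn Yn) (d_ord_isoE R Yn Zn) (d_ord_isoE R Xn Zn).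
  exact: d_ord_triangle Xn Yn Zn.
Qed.
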